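(* Let $d\ge 3$ and let $a_1,\ldots,a_d:(0,\infty)\to(0,\infty)$ be continuous, strictly increasing functions. For $t>0$ put $v(t)=(1,t,t^2,\ldots,t^{d-1})$ and $a(t)=(a_1(t),-a_2(t),a_3(t),\ldots,(-1)^{d-1}a_d(t))$, and let $L(t)$ be the oriented line represented by $(a(t),v(t))$. Then the family $L(t)$, $t\in(0,\infty)$, is continuous and universal, and its type is the identity permutation of $[d-1]$.
   Context: An oriented line in $\mathbb{R}^d$ is an equivalence class of pairs $(a,v)$, $v\ne0$, representing $\{a+sv\}$, with $(a,v)\sim(a+\alpha v,\beta v)$ for $\alpha\in\mathbb{R}$, $\beta>0$. A family $L(t)$, $t\in I$ ($I$ an open interval), is continuous if $t\mapsto L(t)$ is continuous in the natural topology of the space of oriented lines (equivalently, writing $L(t)$ with $v(t)$ a unit vector and $a(t)$ the point of $L(t)$ on the hyperplane $\{x:v(t)\cdot x=0\}$, both $a(t)$ and $v(t)$ are continuous). For an ordered $(d-1)$-tuple of oriented lines represented by $(a_i,v_i)$ set $h_i=\det(a_i,v_1,\ldots,v_{d-1})$; the tuple is in general position if the $h_i$ are distinct and its type is the permutation $\sigma$ of $[d-1]$ with $h_{\sigma(1)}<\dots<h_{\sigma(d-1)}$. The family is universal of type $\sigma$ if for all $t_1<\dots<t_{d-1}$ in $I$ the tuple $L(t_1),\ldots,L(t_{d-1})$ is in general position and has type $\sigma$. *)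

(* Defs.v *)
From HB Require Import structures.
From mathcomp Require Import all_boot all_order all_algebra all_fingroup.
From mathcomp Require Import generic_quotient.
From mathcomp Require Import all_classical all_reals all_analysis.

Set Implicit Arguments.
Unset Strict Implicit.
Unset Printing Implicit Defensive.

Import Order.TTheory GRing.Theory Num.Theory.
Import numFieldNormedType.Exports.

Local Open Scope classical_set_scope.
Local Open Scope quotient_scope.
Local Open Scope ring_scope.

Section OrientedLines.
Variables (R : realType) (d : nat).

(* A pair (a, v) with v != 0, standing for the line a + R v oriented by v.
   As a [set_type] it carries the topology induced from R^d * R^d. *)
Definition line_rep : Type :=
  set_type [set p : 'rV[R]_d * 'rV[R]_d | p.2 != 0].
HB.instance Definition _ := Topological.on line_rep.

Definition base (p : line_rep) : 'rV[R]_d := (set_val p).1.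
Definition dir (p : line_rep) : 'rV[R]_d := (set_val p).2.

Definition same_line (p q : line_rep) : Prop :=
  exists alpha beta : R, [/\ 0 < beta,
    base q = base p + alpha *: dir p & dir q = beta *: dir p].

Definition same_lineb (p q : line_rep) : bool := `[< same_line p q >].

Lemma same_lineb_refl : reflexive same_lineb.
Proof. by move=> p; apply/asboolP; exists 0, 1; rewrite scale0r addr0 scale1r. Qed.

Lemma same_line_sym p q : same_line p q -> same_line q p.
Proof.
move=> [al [be [be0 bq dq]]]; exists (- (al / be)), be^-1.
rewrite invr_gt0 bq dq !scalerA mulNr divfK ?gt_eqF// mulVf ?gt_eqF// scale1r.
by split=> //; rewrite scaleNr addrK.
Qed.

Lemma same_lineb_sym : symmetric same_lineb.
Proof. by move=> p q; apply/asboolP/asboolP; exact: same_line_sym. Qed.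

Lemma same_lineb_trans : transitive same_lineb.
Proof.
move=> q p r /asboolP[al [be [be0 bq dq]]] /asboolP[al' [be' [be'0 br dr]]].
apply/asboolP; exists (al + al' * be), (be' * be); split.
- exact: mulr_gt0.
- by rewrite br bq dq scalerA scalerDl addrA.
- by rewrite dr dq scalerA.
Qed.

Canonical same_line_equiv :=
  EquivRel same_lineb same_lineb_refl same_lineb_sym same_lineb_trans.

(* The space of oriented lines, with the quotient topology. *)
Definition oriented_line : Type :=
  quotient_topology {eq_quot same_line_equiv}.
HB.instance Definition _ := Topological.on oriented_line.
HB.instance Definition _ := Quotient.on oriented_line.

Lemma eq_oriented_line (p q : line_rep) :
  \pi_oriented_line p = \pi_oriented_line q <-> same_line p q.
Proof.
have E : (p == q %[mod {eq_quot same_line_equiv}]) = same_lineb p q.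
  exact: eqmodE.
split=> [pq|/asboolP pq].
  by apply/asboolP; rewrite -/(same_lineb p q) -E; apply/eqP; exact: pq.
by have /eqP := etrans E pq; apply.
Qed.

Definition oline (a v : 'rV[R]_d) (hv : v != 0) : oriented_line :=
  \pi_oriented_line (exist _ (a, v) (mem_set hv) : line_rep).

End OrientedLines.

(* n-tuples of oriented lines in R^n.+1, i.e. d = n.+1. *)
Section TypeOfTuple.
Variables (R : realType) (n : nat).

Definition height (p : 'I_n -> line_rep R n.+1) (i : 'I_n) : R :=
  \det (col_mx (base (p i)) (\matrix_(k < n) dir (p k)) : 'M[R]_n.+1).

(* The next two notions are read off the canonical representatives; by
   [general_positionE] and [has_typeE] any other choice gives the same. *)
Definition general_position (l : 'I_n -> oriented_line R n.+1) : Prop :=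
  injective (height (fun i => repr (l i))).

Definition has_type (l : 'I_n -> oriented_line R n.+1) (s : 'S_n) : Prop :=
  {homo (fun i => height (fun k => repr (l k)) (s i)) :
    i j / (i < j)%N >-> i < j}.

Lemma height_same_line (p q : 'I_n -> line_rep R n.+1) :
  (forall i, same_line (p i) (q i)) ->
  exists2 c : R, 0 < c & forall i, height q i = c * height p i.
Proof.
move=> /choice[al /choice[be pq]].
exists (\prod_k be k); first by apply: prodr_gt0 => k _; case: (pq k).
move=> i; pose D := diag_mx (\row_k be k).
pose U : 'M[R]_(1 + n) := block_mx 1%:M (al i *: delta_mx 0 i) 0 D.
have -> : \prod_k be k = \det U.
  rewrite det_ublock det1 mul1r det_diag.
  by apply: eq_bigr => k _; rewrite mxE.
rewrite /height -[RHS]det_mulmx; congr (\det _).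
have [_ bq _] := pq i.
rewrite -[RHS]/(U *m col_mx _ _) mul_block_col mul0mx add0r mul1mx bq.
rewrite -scalemxAl -rowE rowK.
have -> : \matrix_k dir (q k) = D *m \matrix_k dir (p k); last by [].
apply/row_matrixP => k; rewrite row_mul row_diag_mx mxE -scalemxAl -rowE !rowK.
by have [_ _ ->] := pq k.
Qed.

Lemma height_repr (l : 'I_n -> oriented_line R n.+1)
    (p : 'I_n -> line_rep R n.+1) :
  (forall i, \pi_(oriented_line R n.+1) (p i) = l i) ->
  exists2 c : R, 0 < c &
    forall i, height (fun k => repr (l k)) i = c * height p i.
Proof.
move=> pl; apply: height_same_line => i; apply/eq_oriented_line.
by rewrite reprK; exact: pl.
Qed.

Lemma general_positionE (l : 'I_n -> oriented_line R n.+1)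
    (p : 'I_n -> line_rep R n.+1) :
  (forall i, \pi_(oriented_line R n.+1) (p i) = l i) ->
  general_position l <-> injective (height p).
Proof.
move=> /height_repr[c c0 E]; rewrite /general_position.
by split=> inj i j; [move=> ij; apply: inj; rewrite !E ij
  | rewrite !E => /(mulfI (lt0r_neq0 c0)); exact: inj].
Qed.

Lemma has_typeE (l : 'I_n -> oriented_line R n.+1)
    (p : 'I_n -> line_rep R n.+1) (s : 'S_n) :
  (forall i, \pi_(oriented_line R n.+1) (p i) = l i) ->
  has_type l s <->
  {homo (fun i => height p (s i)) : i j / (i < j)%N >-> i < j}.
Proof.
move=> /height_repr[c c0 E]; rewrite /has_type.
by split=> h i j /h; rewrite !E ltr_pM2l.
Qed.

Definition universal_of_type (I : set R) (L : R -> oriented_line R n.+1)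
    (s : 'S_n) : Prop :=
  forall t : 'I_n -> R, (forall i, I (t i)) ->
    {homo t : i j / (i < j)%N >-> i < j} ->
    general_position (L \o t) /\ has_type (L \o t) s.

Definition moment_dir (t : R) : 'rV[R]_n.+1 := \row_j t ^+ j.

Definition alternating_base (a : 'I_n.+1 -> R -> R) (t : R) : 'rV[R]_n.+1 :=
  \row_j ((-1) ^+ j * a j t).

Lemma moment_dir_neq0 (t : R) : moment_dir t != 0.
Proof.
apply/eqP => /rowP/(_ ord0); rewrite !mxE expr0 => /eqP.
by rewrite oner_eq0.
Qed.

Definition moment_line (a : 'I_n.+1 -> R -> R) (t : R) : oriented_line R n.+1 :=
  oline (alternating_base a t) (moment_dir_neq0 t).

End TypeOfTuple.

(* Main.v *)
Require Import Defs.
From mathcomp Require Import all_boot all_order all_algebra all_fingroup.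
From mathcomp Require Import all_classical all_reals all_analysis.
Import Order.TTheory GRing.Theory Num.Theory.
Import numFieldNormedType.Exports.
Local Open Scope classical_set_scope.
Local Open Scope ring_scope.

(* Expanding det(a(t_i), v(t_1), ..., v(t_n)) along the row a(t_i), the signs
   of a(t_i) cancel those of the cofactors, so h_i is the sum of the
   a_j(t_i) M_j, where M_j is the minor of the matrix (t_k^m) without its
   column j.  By the Vandermonde formula with the extra node -X, the generating
   polynomial of the M_j is the product of the t_k + X times the product of the
   t_l - t_k, k < l; so all M_j are positive and h_i increases with t_i. *)

(** Multiplying [p] by [X + c] turns coefficient [j.+1] into [p_j + c p_(j+1)]. At the top degree
    [p_(j+1)] vanishes, so the induction also carries nonnegativity for every [j]. *)
Lemma coef_prodXaddC_ge0_gt0 (R : numDomainType) (n : nat) (c : 'I_n -> R) :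
  (forall i, 0 < c i) -> forall j : nat,
  0 <= (\prod_i ('X + (c i)%:P))`_j /\
  ((j <= n)%N -> 0 < (\prod_i ('X + (c i)%:P))`_j).
Proof.
elim: n c => [|n IHn] c c_gt0 j.
  by rewrite big_ord0 coef1; case: j.
rewrite big_ord_recl mulrDl coefD coefXM coefCM.
have := IHn (fun i => c (lift ord0 i)) (fun i => c_gt0 _).
set p := \prod_i _ => /= IHc.
have [p_ge0 p_gt0] := IHc j.
have cp_ge0 : 0 <= c ord0 * p`_j by rewrite mulr_ge0// ltW.
case: j => [|j] /= in p_ge0 p_gt0 cp_ge0 *.
  by rewrite add0r; split=> // _; rewrite mulr_gt0// p_gt0.
have [q_ge0 q_gt0] := IHc j.
by split=> [|jn]; [rewrite addr_ge0|rewrite ltr_wpDr// q_gt0].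
Qed.

Lemma coef_prodXaddC_gt0 (R : numDomainType) (n : nat) (c : 'I_n -> R)
    (j : nat) :
  (forall i, 0 < c i) -> (j <= n)%N -> 0 < (\prod_i ('X + (c i)%:P))`_j.
Proof. by move=> /coef_prodXaddC_ge0_gt0/(_ j)[_]. Qed.

Lemma col_mx_ord0E (T : Type) (m n : nat) (u : 'rV[T]_m) (A : 'M[T]_(n, m))
    (j : 'I_m) :
  (col_mx u A : 'M[T]_(n.+1, m)) ord0 j = u ord0 j.
Proof. by rewrite -(col_mxEu u A); congr (col_mx u A _ j); apply/val_inj. Qed.

Lemma col_mx_lift0E (T : Type) (m n : nat) (u : 'rV[T]_m) (A : 'M[T]_(n, m))
    (i : 'I_n) (j : 'I_m) :
  (col_mx u A : 'M[T]_(n.+1, m)) (lift ord0 i) j = A i j.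
Proof. by rewrite -(col_mxEd u A); congr (col_mx u A _ j); apply/val_inj. Qed.

Lemma cofactor_moment_poly (R : realType) (n : nat) (u : 'rV[R]_n.+1)
    (t : 'I_n -> R) :
  \sum_(j < n.+1)
    ((-1) ^+ j *
      cofactor (col_mx u (\matrix_k moment_dir n (t k)) : 'M[R]_n.+1) ord0 j)
        *: 'X^j =
  (\prod_(k < n) \prod_(l < n | (k < l)%N) (t l - t k)) *:
    \prod_k ('X + (t k)%:P).
Proof.
(* The node [- 'X] comes first: its powers supply the signs [(-1) ^+ j], and each difference of a
   later node with it is [t_k + 'X], without a sign. *)
pose x : 'rV[{poly R}]_n.+1 :=
  \row_i if unlift ord0 i is Some k then (t k)%:P else - 'X.
have x0 : x 0 ord0 = - 'X by rewrite mxE unlift_none.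
have xS k : x 0 (lift ord0 k) = (t k)%:P by rewrite mxE liftK.
transitivity (\det (Vandermonde n.+1 x)).
  (* [Vandermonde] has one column per node, hence the transposition. Row 0 is the only one involving
     ['X] and the only one where [u] would stand; the cofactors delete it, so they are constants,
     equal to those of the statement. *)
  rewrite -det_tr (expand_det_row _ ord0); apply: eq_bigr => j _.
  rewrite !mxE unlift_none [in RHS]exprNn -mul_polyC polyCM polyC_exp polyCN.
  rewrite mulrAC; congr (_ * _); rewrite -cofactor_map_mx /cofactor.
  congr (_ * \det _); apply/matrixP => i k.
  rewrite 3!mxE [RHS]mxE col_mx_lift0E !mxE liftK.
  exact: polyC_exp.
(* The pairs containing the first node give the product of the ['X + t_k]; the other pairs give the
   constant factor. *)
rewrite det_Vandermonde big_ord_recl /= [X in X * _]big_mkcond big_ord_recl /=.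
rewrite mul1r mulrC -mul_polyC; congr (_ * _).
  rewrite rmorph_prod; apply: eq_bigr => k _.
  rewrite rmorph_prod big_mkcond big_ord_recl /= mul1r [RHS]big_mkcond.
  by apply: eq_bigr => l _; rewrite !xS rmorphB.
by apply: eq_bigr => k _; rewrite /= xS x0 opprK addrC.
Qed.

Lemma cofactor_moment_gt0 (R : realType) (n : nat) (u : 'rV[R]_n.+1)
    (t : 'I_n -> R) (j : 'I_n.+1) :
  (forall i, 0 < t i) -> {homo t : i k / (i < k)%N >-> i < k} ->
  0 < (-1) ^+ j *
    cofactor (col_mx u (\matrix_k moment_dir n (t k)) : 'M[R]_n.+1) ord0 j.
Proof.
move=> t_gt0 t_incr.
have /(congr1 (fun p : {poly R} => p`_j)) := cofactor_moment_poly _ _ u t.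
rewrite coef_sum coefZ (bigD1 j) //= big1 => [|k kj].
  rewrite coefZ coefXn eqxx mulr1 addr0 => ->.
  apply: mulr_gt0; last by apply: coef_prodXaddC_gt0; rewrite // -ltnS.
  by do 2!apply: prodr_gt0 => ? ?; rewrite subr_gt0 t_incr.
by rewrite coefZ coefXn (inj_eq val_inj) eq_sym (negPf kj) mulr0.
Qed.

(** A neighbourhood of a matrix contains a product of neighbourhoods of its finitely many entries,
    and a filter is closed under finite intersections. *)
Lemma cvg_matrix (T : Type) (U : topologicalType) (m n : nat)
    (F : set_system T) (FF : Filter F) (M : T -> 'M[U]_(m, n))
    (N : 'M[U]_(m, n)) :
  (forall i j, M x i j @[x --> F] --> N i j) -> M x @[x --> F] --> N.
Proof.
move=> MN A [P /= NP PA]; apply: (filterS PA).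
apply: filter_forall => i; apply: filter_forall => j.
exact: MN (NP i j).
Qed.

(** The family lifts to representatives. The lift is continuous because [line_rep] has the initial
    topology of its inclusion into pairs, and the quotient map is continuous. *)
Lemma within_continuous_oline (R : realType) (d : nat) (D : set R)
    (a v : R -> 'rV[R]_d) (v_neq0 : forall t, v t != 0) :
  {within D, continuous a} -> {within D, continuous v} ->
  {within D, continuous (fun t => oline (a t) (v_neq0 t))}.
Proof.
move=> ca cv.
pose p (t : subspace D) : line_rep R d :=
  exist _ (a t, v t) (mem_set (v_neq0 t)).
have cp : continuous p.
  apply: continuous_comp_initial => t.
  exact: (@cvg_pair _ _ _ _ _ _ (nbhs_filter t) (nbhs_filter (a t))
    (nbhs_filter (v t)) a v (ca t) (cv t)).
move=> t.
apply: (@continuous_comp _ _ _ p (\pi_(oriented_line R d)%qT) t (cp t)).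
exact: pi_continuous.
Qed.

Lemma height_moment_lt (R : realType) (n : nat) (a : 'I_n.+1 -> R -> R)
    (t : 'I_n -> R) (p : 'I_n -> line_rep R n.+1) :
  (forall k, base (p k) = alternating_base a (t k)) ->
  (forall k, dir (p k) = moment_dir n (t k)) ->
  (forall k, 0 < t k) -> {homo t : i k / (i < k)%N >-> i < k} ->
  (forall (i : 'I_n.+1) (s s' : R), 0 < s -> s < s' -> a i s < a i s') ->
  {homo height p : i j / (i < j)%N >-> i < j}.
Proof.
move=> bp dp t_gt0 t_incr a_incr i k ik.
(* Taking 0 as the first row makes the cofactors visibly the same for all [l], so two heights can be
   compared term by term. *)
have hE l : height p l = \sum_(j < n.+1) a j (t l) * ((-1) ^+ j *
    cofactor (col_mx (0 : 'rV[R]_n.+1) (\matrix_k moment_dir n (t k))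
      : 'M[R]_n.+1) ord0 j).
  rewrite /height (expand_det_row _ ord0); apply: eq_bigr => j _.
  rewrite col_mx_ord0E bp mxE [RHS]mulrCA mulrA; congr (_ * _).
  rewrite /cofactor; congr (_ * \det _); apply/matrixP => k' j'.
  by rewrite 2!mxE [RHS]mxE [RHS]mxE !col_mx_lift0E !mxE dp mxE.
rewrite !hE; apply: ltr_sum => [|j _].
  by apply/hasP; exists ord0; rewrite ?mem_index_enum.
by rewrite ltr_pM2r ?cofactor_moment_gt0// a_incr// t_incr.
Qed.

Theorem theorem9p2 (R : realType) (n : nat) (hd : (3 <= n.+1)%N)
    (a : 'I_n.+1 -> R -> R)
    (a_pos : forall (i : 'I_n.+1) (t : R), 0 < t -> 0 < a i t)
    (a_cont : forall i : 'I_n.+1, {within `]0, +oo[, continuous (a i)})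
    (a_incr : forall (i : 'I_n.+1) (s t : R), 0 < s -> s < t -> a i s < a i t) :
  {within `]0, +oo[, continuous (moment_line a)} /\
  universal_of_type `]0, +oo[ (moment_line a) (1%g : 'S_n).
Proof.
split.
  apply: within_continuous_oline; apply/subspace_continuousP => t t_pos;
    apply: cvg_matrix => i j; rewrite mxE.
    under eq_fun do rewrite mxE.
    apply: cvgM; first exact: cvg_cst.
    by move/subspace_continuousP: (a_cont j); exact.
  under eq_fun do rewrite mxE.
  apply: cvg_within_filter; exact: exprn_continuous.
move=> t t_pos t_incr.
pose p k : line_rep R n.+1 := exist _
  (alternating_base a (t k), moment_dir n (t k))
  (mem_set (moment_dir_neq0 n (t k))).
(* General position and type may be tested on any representatives, here the defining pairs. *)
have p_lift k : \pi_(oriented_line R n.+1)%qT (p k) = (moment_line a \o t) k.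
  by [].
have t_gt0 k : 0 < t k by have := t_pos k; rewrite /= in_itv /= andbT.
have h_incr : {homo height p : i j / (i < j)%N >-> i < j}.
  exact: (@height_moment_lt _ _ a t).
split; last by apply/(has_typeE _ p_lift) => i j ij; rewrite !perm1 h_incr.
apply/(general_positionE p_lift) => i j hij; apply/val_inj/eqP.
by case: ltngtP => // /h_incr; rewrite hij ltxx.
Qed.
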